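(* Let $S\subseteq\mathbb N$ be such that $F_S(q)=\sum_{n=0}^\infty C_S(n)q^n$ is analytic and has no zeros on $\{q\in\mathbb C:|q|<1\}$, and such that the limit $L=\lim_{q\to1}F_S(q)$ exists (possibly infinite) as $q\to1$ radially from within the unit disk. If $L$ is infinite, then $d_S=0$. If $L\ge 1$ is finite, then $d_S=1/L$. The case $L<1$ cannot occur.
   Context: $\mathbb N=\{1,2,3,\dots\}$. For $S\subseteq\mathbb N$, the arithmetic density is $d_S:=\lim_{N\to\infty}\#\{n\in S: n\le N\}/N$. A partition $\lambda$ is a finite multiset of positive integers (parts), including the empty partition; $|\lambda|$ is the sum of its parts, $\ell(\lambda)$ the number of parts, and $m_i=m_i(\lambda)$ the multiplicity of $i$ as a part. $\mathcal P_S$ denotes the set of partitions all of whose parts lie in $S$ (including the empty partition). Define $$C_S(n):=\sum_{\substack{\lambda\in\mathcal P_S\\ 0\le|\lambda|\le n}}\frac{(-1)^{\ell(\lambda)}\,\ell(\lambda)!}{m_1!\,m_2!\,m_3!\cdots m_n!},$$ (the empty partition contributes $1$), and $F_S(q):=\sum_{n\ge0}C_S(n)q^n$. *)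

(* Defs.v *)
From mathcomp Require Import all_boot all_order all_algebra.
From mathcomp Require Import finmap multiset.
From mathcomp Require Import all_classical all_reals all_analysis.
From mathcomp Require Import complex.

Set Implicit Arguments.
Unset Strict Implicit.
Unset Printing Implicit Defensive.

Import Order.TTheory GRing.Theory Num.Theory.
Import numFieldNormedType.Exports.

Local Open Scope classical_set_scope.
Local Open Scope mset_scope.
Local Open Scope ring_scope.

(* Subsets of {1, 2, 3, ...} are sets S : set nat with ~ S 0. *)

Definition has_density (R : realType) (S : set nat) (d : R) : Prop :=
  (count (fun n => n \in S) (iota 1 N))%:R / N%:R @[N --> \oo] --> d.

Definition partitions_in (S : set nat) : set ({mset nat}) :=
  [set lam : {mset nat} | forall i, i \in lam -> (0 < i)%N /\ S i].

Definition psize (lam : {mset nat}) : nat := (\sum_(i <- lam) i)%N.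

Definition plength (lam : {mset nat}) : nat := size lam.

(* lam i is the multiplicity of i in lam.  The index set of the outer sum is
   finite, so this finitely supported sum is the usual one. *)
Definition CS (R : realType) (S : set nat) (n : nat) : R :=
  \sum_(lam \in partitions_in S `&` [set lam | (psize lam <= n)%N])
    ((-1) ^+ plength lam * (plength lam)`!%:R
      / \prod_(1 <= i < n.+1) (lam i)`!%:R : R).

(* R[i]^o is R[i] with its usual topology and complex vector space structure;
   derivability below is therefore complex differentiability. *)
Definition FS_term (R : realType) (S : set nat) (q : R[i]) : nat -> R[i]^o :=
  fun n => (CS R S n)%:C%C * q ^+ n.

Definition FS (R : realType) (S : set nat) (q : R[i]^o) : R[i]^o :=
  limn (series (FS_term S q)).

Definition FS_analytic_on_disk (R : realType) (S : set nat) : Prop :=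
  forall q : R[i]^o, `|q| < 1 ->
    cvgn (series (FS_term S q)) /\ derivable (@FS R S) q 1.

(* Some l is a finite limit l; None is an infinite limit, |f(x)| -> +oo. *)
Definition radial_limit (R : realType) (f : R[i]^o -> R[i]^o)
    (L : option R[i]) : Prop :=
  match L with
  | Some l => f x%:C%C @[x --> (1 : R)^'-] --> (l : R[i]^o)
  | None => ComplexField.Normc.normc (f x%:C%C) @[x --> (1 : R)^'-] --> +oo
  end.

(* Main.v *)
(* Removing one part k from a partition turns the weight l! / prod m_i! into
   the recurrence C(n) + sum_(k in S, k <= n) C(n - k) = 1, that is
   F(q) (1 - q) (1 + s(q)) = 1 with s(q) = sum_(k in S) q^k.  As
   0 <= (1 - x) s(x) <= x on [0, 1[, the values F(x) are real and at least 1,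
   and (1 - x) s(x) tends to 1 / L.  The density then follows from a Tauberian
   theorem for bounded coefficients, proved with the polynomials
   1 - (1 - t^j)^(2^j), which approximate the indicator function of t > 1/2. *)

Require Import Defs.
From mathcomp Require Import all_boot all_order all_algebra.
From mathcomp Require Import finmap multiset.
From mathcomp Require Import all_classical all_reals all_analysis.
From mathcomp Require Import complex.
From mathcomp Require Import ring lra.

Set Implicit Arguments.
Unset Strict Implicit.
Unset Printing Implicit Defensive.

Import Order.TTheory GRing.Theory Num.Theory.
Import numFieldNormedType.Exports.

Local Open Scope classical_set_scope.
Local Open Scope ring_scope.

(** * A Tauberian theorem for bounded coefficients *)

Lemma bernoulli (R : realDomainType) (x : R) n : -1 <= x ->
  1 + x *+ n <= (1 + x) ^+ n.
Proof.
move=> x1; elim: n => [|n IHn]; first by rewrite mulr0n addr0 expr0.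
have x10 : 0 <= 1 + x by rewrite -lerBlDl sub0r.
rewrite exprS; apply: le_trans (ler_wpM2l x10 IHn).
rewrite mulrS mulrDl mul1r mulrDr mulr1.
have : 0 <= x * (x *+ n) by rewrite mulrnAr mulrn_wge0// -expr2 sqr_ge0.
lra.
Qed.

(** * Polynomial approximation of the indicator of t > 1/2 *)

Section step_polynomial.
Variable R : realType.
Implicit Types (x t u : R) (n m j N M : nat).

(** By Bernoulli u m <= (1 + u)^m, and (1 - u)^m (1 + u)^m <= 1. With u = t^j and m = 2^j this
    bounds the distance from [step_poly] to 1 when t > 1/2; [subr1_exp_ge] bounds its distance to 0
    when t < 1/2. *)
Lemma subr1_exp_le u m : 0 <= u <= 1 -> (1 - u) ^+ m * (u *+ m) <= 1.
Proof.
move=> /andP[u0 u1].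
have h1 : u *+ m <= (1 + u) ^+ m.
  apply: le_trans (bernoulli m _); first by rewrite lerDr.
  by rewrite (le_trans _ u0)// lerN10.
have h2 : 0 <= (1 - u) ^+ m by rewrite exprn_ge0 // subr_ge0.
apply: le_trans (ler_wpM2l h2 h1) _.
rewrite -exprMn; apply: exprn_ile1; nra.
Qed.

Lemma subr1_exp_ge u m : 0 <= u <= 1 -> 1 - (1 - u) ^+ m <= u *+ m.
Proof.
move=> /andP[u0 u1]; have := @bernoulli R (- u) m; rewrite lerN2 => /(_ u1).
by rewrite mulNrn; lra.
Qed.

(** The exponent 2^j puts the jump at 1/2: the behaviour is governed by 2^j t^j = (2 t)^j, which is
    large for t > 1/2 and small for t < 1/2. *)
Definition step_poly j : {poly R} := 1 - (1 - 'X^j) ^+ (2 ^ j).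

Lemma step_polyE j t : (step_poly j).[t] = 1 - (1 - t ^+ j) ^+ (2 ^ j).
Proof. by rewrite /step_poly !hornerE. Qed.

Lemma step_poly_coef0 j : (0 < j)%N -> (step_poly j)`_0 = 0.
Proof.
move=> j0; rewrite -horner_coef0 step_polyE expr0n eqn0Ngt j0 /= subr0.
by rewrite expr1n subrr.
Qed.

Lemma sumr_expr_le x n : 0 <= x < 1 -> \sum_(i < n) x ^+ i <= (1 - x)^-1.
Proof.
move=> /andP[x0 x1]; have x1' : 0 < 1 - x by rewrite subr_gt0.
rewrite -[leRHS]mul1r ler_pdivlMr// mulrC -opprB mulNr -subrX1 opprB.
by rewrite gerBl exprn_ge0.
Qed.

(** Put y = x^j, so that 2^j y^N = 1. The error is at most y^(i+1) at index N - 1 - i and at most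
    y^i at index N + i. Both sides are thus dominated by a geometric series of sum 1 / (1 - y),
    uniformly in M. *)
Lemma step_poly_error x N M j (b : nat -> R) : (0 < N)%N -> (N <= M)%N ->
  (0 < j <= N)%N -> 0 <= x < 1 -> x ^+ N = 2^-1 -> (forall n, `|b n| <= 1) ->
  `|\sum_(n < N) b n - \sum_(n < M) b n * (step_poly j).[x ^+ n]|
    <= (8 / j%:R) * N%:R.
Proof.
move=> N0 /subnKC <-; move: (M - N)%N => m /andP[j0 jN] /andP[x0 x1] xN b1.
have xgt0 : 0 < x.
  rewrite lt_neqAle x0 andbT; apply/eqP => xE; move: xN.
  by rewrite -xE expr0n eqn0Ngt N0 => /eqP; rewrite eq_sym invr_eq0 pnatr_eq0.
pose y := x ^+ j.
have y0 : 0 < y by rewrite exprn_gt0.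
have y1 : y < 1 by rewrite exprn_ilt1// -lt0n.
have yN : y ^+ N *+ (2 ^ j) = 1.
  rewrite /y exprAC xN -mulr_natl natrX -exprMn mulfV ?pnatr_eq0//.
  by rewrite expr1n.
(* For i < j <= N each x^i is at least x^N = 1/2, so 1 - y >= (1 - x) j / 2; and 1/2 = 1 - x^N <= (1
   - x) N. Together j <= 4 (1 - y) N. *)
have ybd : (1 - y)^-1 *+ 2 <= 8 / j%:R * N%:R.
  have xj : 2^-1 <= x ^+ j by rewrite -xN ler_wiXn2l // ltW.
  have h1 : (1 - x) * (j%:R / 2) <= 1 - y.
    have -> : 1 - y = (1 - x) * \sum_(i < j) x ^+ i.
      by rewrite -opprB subrX1 -mulNr opprB.
    apply: ler_wpM2l; first by rewrite subr_ge0 ltW.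
    have -> : j%:R / 2 = \sum_(i < j) 2^-1 :> R.
      by rewrite sumr_const card_ord mulr_natl.
    apply: ler_sum => i _; apply: le_trans xj _.
    by apply: ler_wiXn2l => //; [exact: ltW | exact: ltnW].
  have h2 : 1 <= (1 - x) * N%:R * 2.
    have := subr1_exp_ge N (u := 1 - x).
    rewrite subKr xN -mulr_natr => /(_ _).
    have -> : 0 <= 1 - x <= 1 by apply/andP; split; lra.
    by move=> /(_ isT); lra.
  have jR : 0 < j%:R :> R by rewrite ltr0n.
  have NR : 0 < N%:R :> R by rewrite ltr0n.
  have y1' : 0 < 1 - y by rewrite subr_gt0.
  have h3 : j%:R <= 4 * ((1 - y) * N%:R).
    nra.
  rewrite -[_ *+ 2]mulr_natl ler_pdivrMr// [8 / _]mulrC -!mulrA ler_pdivlMl//.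
  nra.
apply: le_trans ybd; rewrite mulr2n.
rewrite big_split_ord /= opprD addrA -sumrB; apply: le_trans (ler_normB _ _) _.
have yE n : (x ^+ n) ^+ j = y ^+ n by rewrite exprAC.
have ybnd n : 0 <= y ^+ n <= 1 by rewrite exprn_ge0 ?exprn_ile1 // ltW.
apply: lerD.
- apply: le_trans (sumr_expr_le N (x := y) _); last by rewrite (ltW y0).
  rewrite (reindex_inj rev_ord_inj) /=.
  apply: le_trans (ler_norm_sum _ _ _) _; apply: ler_sum => i _.
  rewrite step_polyE yE -{1}[b _]mulr1 -mulrBr subKr normrM.
  rewrite -[leRHS]mul1r; apply: ler_pM => //.
  have /andP[_ yle1] := ybnd (N - i.+1)%N.
  rewrite ger0_norm; last by rewrite exprn_ge0 // subr_ge0.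
  have := subr1_exp_le (2 ^ j) (ybnd (N - i.+1)%N).
  have -> : y ^+ (N - i.+1) *+ 2 ^ j = (y ^+ i.+1)^-1.
    apply: (mulIf (x := y ^+ i.+1)); first by rewrite expf_neq0 // gt_eqF.
    by rewrite mulVf ?expf_neq0 ?gt_eqF// mulrnAl -exprD subnK.
  rewrite ler_pdivrMr ?exprn_gt0// mul1r => /le_trans; apply.
  by rewrite ler_wiXn2l // ltW.
- apply: le_trans (sumr_expr_le m (x := y) _); last by rewrite (ltW y0).
  apply: le_trans (ler_norm_sum _ _ _) _; apply: ler_sum => i _.
  rewrite step_polyE yE normrM -[leRHS]mul1r; apply: ler_pM => //.
  rewrite ger0_norm; last first.
    rewrite subr_ge0 exprn_ile1 //; case/andP: (ybnd (N + i)%N) => *; lra.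
  apply: le_trans (subr1_exp_ge _ (ybnd _)) _.
  by rewrite exprD -mulrnAl yN mul1r.
Qed.

End step_polynomial.

(** * Karamata's method for bounded coefficients *)

Section tauberian.
Variable R : realType.
Implicit Types (x : R) (b : R ^nat).

Definition power_series b x : R := limn (series (fun n => b n * x ^+ n)).

Lemma is_cvg_bounded_power_series b K x : (forall n, `|b n| <= K) ->
  0 <= x < 1 -> cvgn (series (fun n => b n * x ^+ n)).
Proof.
move=> bK /andP[x0 x1]; apply: normed_cvg.
apply: (@series_le_cvg _ _ (geometric K x)) => [n|n|n|].
- exact: normr_ge0.
- by apply: geometric_ge0 => //; exact: le_trans (bK 0%N).
- by rewrite /= normrM normrX (ger0_norm x0) ler_wpM2r// exprn_ge0.
- by apply: is_cvg_geometric_series; rewrite ger0_norm.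
Qed.

Lemma cvg_sum_horner b x (p : {poly R}) : (forall n, `|b n| <= 1) ->
  0 <= x < 1 -> p`_0 = 0 ->
  \sum_(n < M) b n * p.[x ^+ n] @[M --> \oo] -->
    \sum_(k < size p) p`_k * power_series b (x ^+ k).
Proof.
move=> b1 /andP[x0 x1] p0.
have -> : (fun M => \sum_(n < M) b n * p.[x ^+ n]) = (fun M =>
    \sum_(k < size p) p`_k * series (fun n => b n * (x ^+ k) ^+ n) M).
  apply/funext => M; rewrite /series /=.
  under eq_bigr do rewrite horner_coef mulr_sumr.
  rewrite exchange_big /=; apply: eq_bigr => k _.
  rewrite big_mkord mulr_sumr; apply: eq_bigr => n _.
  by rewrite mulrCA exprAC.
apply: cvg_big => [|[[|k] kp] _ /=]; first exact: add_continuous.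
  by rewrite p0 mul0r; under eq_fun do rewrite mul0r; exact: cvg_cst.
apply: cvgMl_tmp; apply: (is_cvg_bounded_power_series b1).
by rewrite exprn_ge0//= exprn_ilt1.
Qed.

(* Karamata's argument: at x ^ N = 1/2 the indicator of t > 1/2 selects the
   terms n < N, and polynomials without constant term can replace it. *)
Lemma tauberian_bounded b : (forall n, `|b n| <= 1) ->
  (1 - x) * power_series b x @[x --> (1 : R)^'-] --> (0 : R) ->
  (\sum_(n < N) b n) / N%:R @[N --> \oo] --> (0 : R).
Proof.
move=> b1 b0; rewrite -cvg_shiftS /=.
(* This is 2^(-1/(n+1)), the point whose power n + 1 is 1/2; the shift by one keeps N positive. *)
pose r n : R := expR (- ln 2 * harmonic n).
have rX n : r n ^+ n.+1 = 2^-1.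
  by rewrite -expRM_natr /= mulfVK ?pnatr_eq0// expRN lnK// posrE.
have r0 n : 0 < r n by exact: expR_gt0.
have r1 n : r n < 1.
  by rewrite expR_lt1 mulNr oppr_lt0 mulr_gt0 ?ln_gt0 ?ltr1n ?invr_gt0.
have r_cvg1 : r @ \oo --> (1 : R).
  have h : - ln 2 * harmonic n @[n --> \oo] --> (0 : R).
    by rewrite -(mulr0 (- ln 2)); apply: cvgMl_tmp; exact: cvg_harmonic.
  by have := cvg_comp _ _ h (@continuous_expR R 0); rewrite expR0.
have rcvg k : r n ^+ k @[n --> \oo] --> (1 : R).
  by have := cvg_comp _ _ r_cvg1 (@exprn_continuous R k 1); rewrite expr1n.
(* Hence 1 / (n + 1) <= 2 (1 - r n) <= 2 (1 - r n ^ k) for k > 0, which lets [term0] replace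
   division by n + 1 with the Abel factor of the hypothesis. *)
have rN n : 1 <= (1 - r n) * n.+1%:R * 2.
  have := @subr1_exp_ge R (1 - r n) n.+1; rewrite subKr rX -mulr_natr.
  have -> : 0 <= 1 - r n <= 1 by have := r0 n; have := r1 n; lra.
  by move=> /(_ isT); lra.
have term0 k : (0 < k)%N ->
    power_series b (r n ^+ k) / n.+1%:R @[n --> \oo] --> (0 : R).
  move=> k0; have /cvgr0Pnorm_le h : (1 - r n ^+ k) * power_series b (r n ^+ k)
      @[n --> \oo] --> (0 : R).
    move/cvg_at_leftP : b0; apply; split => // n.
    by rewrite exprn_ilt1 ?(ltW (r0 n))// -lt0n.
  apply/cvgr0Pnorm_le => e e0; have e20 : 0 < e / 2 by rewrite divr_gt0.
  near=> n; have : `|(1 - r n ^+ k) * power_series b (r n ^+ k)| <= e / 2.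
    by near: n; exact: h.
  have rk : r n ^+ k <= r n by rewrite -[leRHS]expr1 ler_wiXn2l ?ltW.
  rewrite !normrM normfV ger0_norm ?subr_ge0; last exact: le_trans (ltW (r1 n)).
  rewrite [ `|n.+1%:R|]ger0_norm// ler_pdivrMr ?ltr0n//.
  have := rN n; have := normr_ge0 (power_series b (r n ^+ k)).
  have : 0 < n.+1%:R :> R by rewrite ltr0n.
  move: (n.+1%:R : R) => N; move: `|_| => B N0 B0 N1 Be.
  have h1 : (1 - r n) * B <= e / 2.
    by apply: le_trans Be; rewrite ler_wpM2r// lerD2l lerN2.
  nra.
apply/cvgr0Pnorm_le => e e0.
(* The degree parameter j is fixed before n grows: 8 / j is the relative error in [step_poly_error],
   and the other half of e is left for the polynomial sum [T]. *)
have [j j0 je] : exists2 j, (0 < j)%N & 8 / j%:R <= e / 2.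
  exists (Num.truncn (16 / e)).+1 => //.
  have := truncnS_gt (16 / e); set J : R := (Num.truncn _).+1%:R => Je.
  have J0 : 0 < J by apply: lt_trans Je; rewrite divr_gt0.
  rewrite ler_pdivrMr//; move: Je; rewrite ltr_pdivrMr//; lra.
have /cvgr0Pnorm_le/(_ (e / 2)) T0 : \sum_(k < size (step_poly R j))
    (step_poly R j)`_k * (power_series b (r n ^+ k) / n.+1%:R)
    @[n --> \oo] --> (0 : R).
  rewrite -[X in _ --> X](@big1_eq _ _ +%R _
    (index_enum 'I_(size (step_poly R j))) xpredT).
  apply: cvg_big => [|[[|k] kp] _ /=]; first exact: add_continuous.
    by rewrite step_poly_coef0//; under eq_fun do rewrite mul0r; exact: cvg_cst.
  rewrite -[X in _ --> X](mulr0 ((step_poly R j)`_k.+1)).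
  by apply: cvgMl_tmp; exact: term0.
near=> n.
have jn : (j <= n.+1)%N by near: n; exists j => // m /= jm; exact: leqW.
have nR : 0 < n.+1%:R :> R by rewrite ltr0n.
rewrite normrM normfV [ `|n.+1%:R|]ger0_norm// ler_pdivrMr//.
have rb : 0 <= r n < 1 by rewrite (ltW (r0 n)) r1.
have := cvg_sum_horner b1 rb (step_poly_coef0 R j0).
set T := \sum_(k < _) _ => cvgT.
have Te : `|T| <= e / 2 * n.+1%:R.
  rewrite -ler_pdivrMr// -[n.+1%:R]ger0_norm// -normfV -normrM.
  rewrite /T mulr_suml; under eq_bigr do rewrite -mulrA.
  by near: n; apply: T0; rewrite divr_gt0.
have : `|\sum_(m < n.+1) b m - T| <= 8 / j%:R * n.+1%:R.
  (* The error bound does not depend on the truncation M, so it passes to the limit. *)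
  have cvgE : `|\sum_(m < n.+1) b m -
      \sum_(m < M) b m * (step_poly R j).[r n ^+ m]| @[M --> \oo] -->
      `|\sum_(m < n.+1) b m - T|.
    by apply: cvg_norm; apply: cvgB => //; exact: cvg_cst.
  apply: (cvgr_to_le cvgE).
  near=> M; apply: step_poly_error; rewrite ?j0//.
  by near: M; exact: nbhs_infty_ge.
move=> h; apply: le_trans (_ : `|\sum_(m < n.+1) b m - T| + `|T| <= _).
  by rewrite -{1}(subrK T (\sum_(m < n.+1) b m)) ler_normD.
by rewrite (splitr e) mulrDl lerD// (le_trans h)// ler_wpM2r// ltW.
Unshelve. all: by end_near.
Qed.
End tauberian.

(** * The recurrence for the coefficients *)

Section partitions.
Variable R : realType.

Local Open Scope mset_scope.
Local Open Scope ring_scope.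

Lemma perm_mset1D (K : choiceType) (a : K) (A : {mset K}) :
  perm_eq (a +` A) (a :: A).
Proof.
apply/allP => x _; rewrite /= count_mem_mset mset1DE count_mem_mset.
by rewrite (eq_sym x).
Qed.

Lemma psize_mset1D k lam : psize (k +` lam) = (k + psize lam)%N.
Proof. by rewrite /psize (perm_big _ (perm_mset1D k lam)) big_cons. Qed.

Lemma plength_mset1D k lam : plength (k +` lam) = (plength lam).+1.
Proof. by rewrite /plength (perm_size (perm_mset1D k lam)). Qed.

Lemma mem_leq_psize k (lam : {mset nat}) : k \in lam -> (k <= psize lam)%N.
Proof. by move=> kl; rewrite -(msetB1K kl) psize_mset1D leq_addr. Qed.

Definition partitions_le (S : set nat) n : set ({mset nat}) :=
  partitions_in S `&` [set lam | (psize lam <= n)%N].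

Lemma partitions_in_mset1D (S : set nat) k lam : (0 < k)%N -> S k ->
  partitions_in S (k +` lam) <-> partitions_in S lam.
Proof.
move=> k0 Sk; split=> H i ilam; first by apply: H; rewrite in_mset1D ilam orbT.
by move: ilam; rewrite in_mset1D => /orP[/eqP->|/H].
Qed.

Lemma partitions_le_bij (S : set nat) n k : (0 < k <= n)%N -> S k ->
  set_bij (partitions_le S (n - k))
    (partitions_le S n `&` [set lam : {mset nat} | k \in lam])
    (fun lam => k +` lam).
Proof.
move=> /andP[k0 kn] Sk; split.
- move=> lam [lamS /= szlam]; split; last by rewrite /= mset1D1.
  split; first exact/partitions_in_mset1D.
  by rewrite /= psize_mset1D -leq_subRL.
- by move=> x y _ _ /(congr1 (fun A => A `\ k)); rewrite !msetD1K.
- move=> lam [[lamS /= szlam] klam]; exists (lam `\ k); last by rewrite msetB1K.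
  split; last by rewrite /= leq_subRL// -psize_mset1D msetB1K.
  by apply/(partitions_in_mset1D _ k0 Sk); rewrite msetB1K.
Qed.

(** A nonempty partition arises by adding some part k to a partition of size at most n - k; parts
    are positive, so strong induction applies. *)
Lemma finite_partitions_le (S : set nat) n : finite_set (partitions_le S n).
Proof.
elim/ltn_ind: n => n IHn.
apply: (@sub_finite_set _ _ ([set mset0] `|`
   \bigcup_(k in [set k | (0 < k <= n)%N])
     ((fun lam => k +` lam) @` partitions_le S (n - k)))).
  move=> lam [lamS /= szlam].
  have [->|[k klam]] := mset_0Vmem lam; first by left.
  have [k0 Sk] := lamS _ klam.
  have kn : (k <= n)%N by apply: leq_trans szlam; exact: mem_leq_psize.
  right; exists k => /=; first by rewrite k0.
  have kkn : (0 < k <= n)%N by rewrite k0.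
  by have [_ _ H] := partitions_le_bij kkn Sk; apply: H.
rewrite finite_setU; split; first exact: finite_set1.
apply: bigcup_finite.
  by apply: (@sub_finite_set _ _ `I_n.+1) => // k /= /andP[].
move=> k /= /andP[k0 kn]; apply: finite_image; apply: IHn.
by rewrite ltn_subrL k0 (leq_trans k0).
Qed.

Implicit Types (S : set nat) (n N : nat) (lam : {mset nat}).

(** The range of the product is a separate parameter, so that a partition and the one with a part
    removed are weighted over the same range. Extra indices have multiplicity 0 and contribute 0! =
    1. *)
Definition weight N lam : R :=
  (-1) ^+ plength lam * (plength lam)`!%:R
    / \prod_(1 <= i < N.+1) (lam i)`!%:R.

Lemma prod_fact_psize n N lam : (psize lam <= n <= N)%N ->
  \prod_(1 <= i < N.+1) (lam i)`!%:R = \prod_(1 <= i < n.+1) (lam i)`!%:R :> R.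
Proof.
move=> /andP[ln nN]; rewrite (big_cat_nat _ (n := n.+1))//=.
rewrite [X in _ * X]big_nat [X in _ * X]big1 ?mulr1// => i /andP[ni _].
suff /mset_eq0P -> : i \notin lam by [].
apply/negP => /mem_leq_psize il.
by have := leq_trans (leq_trans ni il) ln; rewrite ltnn.
Qed.

Lemma CS_weight S n N : (n <= N)%N ->
  CS R S n = \sum_(lam \in partitions_le S n) weight N lam.
Proof.
move=> nN; apply: eq_fsbigr => lam; rewrite inE => -[_ /= szlam].
by rewrite /weight (@prod_fact_psize n N)// szlam.
Qed.

Lemma size_mset_range N lam : (forall i, i \in lam -> (0 < i <= N)%N) ->
  plength lam = (\sum_(1 <= i < N.+1) lam i)%N.
Proof.
move=> lamN; rewrite /plength size_mset.
rewrite [RHS](bigID (fun i => i \in lam)) /= [X in (_ + X)%N]big1 ?addn0.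
  rewrite -[RHS]big_filter; apply: perm_big; apply: uniq_perm.
  - exact: fset_uniq.
  - by rewrite filter_uniq// iota_uniq.
  - move=> i; rewrite mem_filter mem_index_iota msuppE.
    by case: (boolP (i \in lam)) => // /lamN ->.
by move=> i /mset_eq0P.
Qed.

Lemma weight_mset1D N k lam : (0 < k <= N)%N ->
  weight N (k +` lam) * ((lam k).+1)%:R = - (plength lam).+1%:R * weight N lam.
Proof.
move=> /andP[k0 kN]; rewrite /weight plength_mset1D factS exprS.
have kr : k \in index_iota 1 N.+1 by rewrite mem_index_iota k0.
rewrite !(bigD1_seq k kr (iota_uniq _ _)) /=.
have -> : \prod_(1 <= i < N.+1 | i != k) ((k +` lam) i)`!%:R =
    \prod_(1 <= i < N.+1 | i != k) (lam i)`!%:R :> R.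
  by apply: eq_bigr => i /negbTE ik; rewrite mset1DE ik.
rewrite mset1DE eqxx add1n factS !natrM.
have p0 : \prod_(1 <= i < N.+1 | i != k) (lam i)`!%:R != 0 :> R.
  rewrite prodf_seq_neq0; apply/allP => i _.
  by rewrite pnatr_eq0 -lt0n fact_gt0 implybT.
have l0 : (lam k)`!%:R != 0 :> R by rewrite pnatr_eq0 -lt0n fact_gt0.
field.
by rewrite p0 l0 /= nat1r pnatr_eq0.
Qed.

(** Multiply by the length l, which is the sum of the multiplicities m_k. By [weight_mset1D], m_k
    times the weight of [lam] is -l times the weight of [lam] with one k removed; then cancel l. *)
Lemma weight_rec N lam : lam != mset0 ->
  (forall i, i \in lam -> (0 < i <= N)%N) ->
  weight N lam = - \sum_(1 <= k < N.+1 | k \in lam) weight N (lam `\ k).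
Proof.
move=> lam0 lamN.
have l0 : (0 < plength lam)%N by rewrite lt0n size_mset_eq0.
have lR : (plength lam)%:R != 0 :> R by rewrite pnatr_eq0 -lt0n.
apply: (mulIf lR); rewrite [in LHS](size_mset_range lamN) natr_sum mulr_sumr.
rewrite (bigID (fun k => k \in lam)) /= [X in _ + X]big1 ?addr0; last first.
  by move=> i /mset_eq0P ->; rewrite mulr0.
rewrite mulNr mulr_suml -sumrN big_nat_cond [RHS]big_nat_cond.
apply: eq_bigr => k /andP[kN klam].
have := @weight_mset1D N k (lam `\ k) kN; rewrite msetB1K// msetB1E eqxx.
rewrite subn1 prednK ?mset_gt0// => ->.
by rewrite -(plength_mset1D k) msetB1K// mulrC mulrN.
Qed.

(** The empty partition gives the 1. Expanding the others by [weight_rec] and exchanging sums, the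
    partitions containing k correspond to those of size at most n - k by removal of k. *)
Lemma CS_rec S n :
  CS R S n = 1 - \sum_(1 <= k < n.+1 | k \in S) CS R S (n - k).
Proof.
rewrite (CS_weight S (leqnn n)).
have fin := finite_partitions_le S n.
have D0 : partitions_le S n mset0.
  split=> [i|]; first by rewrite in_mset0.
  by rewrite /= /psize enum_mset0 big_nil.
rewrite (fsbigD1 mset0)//=; congr (_ + _).
  rewrite /weight /plength size_mset0 expr0 fact0 mulr1 mul1r.
  by rewrite big1 ?invr1// => i _; rewrite mset0E.
(* The empty partition may be put back on the right because its inner sum is empty. *)
have -> : \sum_(lam \in partitions_le S n `\ mset0) weight n lam =
    \sum_(lam \in partitions_le S n)
       - \sum_(1 <= k < n.+1 | k \in (lam : {mset nat})) weight n (lam `\ k).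
  rewrite [RHS](fsbigD1 mset0)//=.
  rewrite [X in _ = - X + _]big1 ?oppr0 ?add0r; last first.
    by move=> i; rewrite in_mset0.
  apply: eq_fsbigr => lam; rewrite inE => -[[lamS /= szlam] lam0].
  apply: weight_rec; first exact/eqP.
  move=> i ilam; have [-> _] := lamS _ ilam.
  by rewrite (leq_trans _ szlam)// mem_leq_psize.
rewrite fsbig_finite// sumrN; congr (- _).
rewrite (exchange_big_dep xpredT) //= [RHS]big_mkcond /= !big_nat.
apply: eq_bigr => k kn; rewrite big_mkcond /= -fsbig_finite//.
have -> : \sum_(lam \in partitions_le S n)
      (if k \in (lam : {mset nat}) then weight n (lam `\ k) else 0) =
    \sum_(lam \in partitions_le S n `&` [set lam : {mset nat} | k \in lam])
      weight n (lam `\ k).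
  rewrite [RHS]fsbig_mkcondr; apply: eq_fsbigr => lam _.
  by rewrite mem_setE.
case: ifPn => [/set_mem Sk|]; last first.
  rewrite notin_setE => Sk; apply: fsbig1 => lam [[lamS _] /= klam].
  by have [] := lamS _ klam.
rewrite (@reindex_fsbig _ _ _ _ _ _ _ _ _ (partitions_le_bij kn Sk)).
rewrite (CS_weight S (leq_subr k n)); apply: eq_fsbigr => lam _.
by rewrite msetD1K.
Qed.

End partitions.

(** * Limits of complex functions and products of series *)

Section complex_limits.
Variable R : realType.

Lemma normc_lt_real (z : R[i]) (e : R) : `|z| < e%:C%C ->
  `|complex.Re z| < e /\ `|complex.Im z| < e.
Proof.
case: z => a b /=; rewrite ltcR => h; split; apply: le_lt_trans h.
  by rewrite -sqrtr_sqr ler_sqrt ?addr_ge0 ?sqr_ge0// lerDl sqr_ge0.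
by rewrite -sqrtr_sqr ler_sqrt ?addr_ge0 ?sqr_ge0// lerDr sqr_ge0.
Qed.

Lemma cvg_Re_Im (T : Type) (F : set_system T) {FF : Filter F}
    (f : T -> R[i]^o) (z : R[i]^o) : f @ F --> z ->
  (complex.Re (f x) @[x --> F] --> complex.Re z) /\
  (complex.Im (f x) @[x --> F] --> complex.Im z).
Proof.
move=> /cvgrPdist_lt fz; split; apply/cvgrPdist_lt => e e0.
  near=> x; have /normc_lt_real[+ _] : `|z - f x| < e%:C%C.
    by near: x; apply: fz; rewrite ltcR.
  by rewrite raddfB.
near=> x; have /normc_lt_real[_] : `|z - f x| < e%:C%C.
  by near: x; apply: fz; rewrite ltcR.
by rewrite raddfB.
Unshelve. all: by end_near. Qed.

End complex_limits.

(** * Mertens' theorem on Cauchy products *)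

Section cauchy_product.
Variable R : realType.

(** Split off the last m terms, with m such that d is small from m on. The earlier terms are small
    since the sums of a are bounded by A; the last m involve fixed values of d and terms of a that
    tend to 0. Dividing by A + 1 avoids the case A = 0. *)
Lemma cvg_convolution0 (a d : R ^nat) : (forall n, 0 <= a n) ->
  cvgn (series a) -> d @ \oo --> (0 : R) ->
  \sum_(k < n) a k * d (n - k.+1)%N @[n --> \oo] --> (0 : R).
Proof.
move=> a0 acv d0; pose A := limn (series a).
have sA n : \sum_(k < n) a k <= A.
  rewrite -(big_mkord xpredT a) -[leLHS]/(series a n).
  apply: nondecreasing_cvgn_le => //; apply: nondecreasing_series => i _ _.
  exact: a0.
have A0 : 0 <= A by have := sA 0%N; rewrite big_ord0.
have acvg0 := cvg_series_cvg_0 acv.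
apply/cvgr0Pnorm_le => e e0.
have e'0 : 0 < e / 2 / (A + 1) by rewrite !divr_gt0// ltr_wpDl.
have [m _ dm] := cvgr0_norm_le _ d0 _ e'0.
have tail0 : \sum_(i < m) a (n + i)%N * d (m - i.+1)%N @[n --> \oo] --> (0 : R).
  rewrite -[X in _ --> X](@big1_eq _ _ +%R _ (index_enum 'I_m) xpredT).
  apply: cvg_big => [|i _]; first exact: add_continuous.
  rewrite -[X in _ --> X](mul0r (d (m - i.+1)%N)); apply: cvgMr_tmp.
  by rewrite (cvg_shiftn i a).
have e20 : 0 < e / 2 by rewrite divr_gt0.
have [N _ tN] := cvgr0_norm_le _ tail0 _ e20.
exists (N + m)%N => // n /= Nn.
have mn : (m <= n)%N by apply: leq_trans Nn; exact: leq_addl.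
have {Nn} Nn : (N <= n - m)%N by rewrite leq_subRL// addnC.
move: mn Nn => /subnK; move: (n - m)%N => p <- Np {n}.
rewrite big_split_ord /= (splitr e); apply: le_trans (ler_normD _ _) _.
apply: lerD; last first.
  have := tN _ Np; congr (`|_| <= _); apply: eq_bigr => i _.
  by rewrite -addnS subnDl.
apply: le_trans (ler_norm_sum _ _ _) _.
apply: le_trans (_ : \sum_(k < p) a k * (e / 2 / (A + 1)) <= _).
  apply: ler_sum => k _; rewrite normrM ger0_norm// ler_wpM2l//.
  by apply: dm => /=; rewrite addnC -addnBA// leq_addr.
rewrite -mulr_suml [leLHS]mulrC -[leLHS]mulrA; apply: ler_piMr (ltW e20) _.
by rewrite ler_pdivrMl ?ltr_wpDl// mulr1 (le_trans (sA p))// lerDl.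
Qed.

(** Here P plays the partial sums of the second factor, which may converge only conditionally. Write
    P as l plus a null sequence. *)
Lemma cvg_convolution (a P : R ^nat) (l : R) : (forall n, 0 <= a n) ->
  cvgn (series a) -> P @ \oo --> l ->
  \sum_(k < n) a k * P (n - k.+1)%N @[n --> \oo] --> limn (series a) * l.
Proof.
move=> a0 acv Pl.
have d0 : P n - l @[n --> \oo] --> (0 : R).
  by rewrite -(subrr l); apply: cvgB => //; exact: cvg_cst.
have -> : (fun n => \sum_(k < n) a k * P (n - k.+1)%N) = (fun n =>
    series a n * l + \sum_(k < n) a k * (P (n - k.+1)%N - l)).
  apply/funext => n; rewrite /series /= big_mkord mulr_suml -big_split /=.
  by apply: eq_bigr => k _; rewrite -mulrDr addrC subrK.
rewrite -[X in _ --> X]addr0; apply: cvgD; last first.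
  exact: (@cvg_convolution0 a (fun n => P n - l)).
exact: cvgMr_tmp.
Qed.

End cauchy_product.

(** * Density *)

Section density.
Variables (R : realType) (S : set nat).
Hypothesis FS_analytic : FS_analytic_on_disk R S.
Implicit Types x A : R.

Let G x : R := complex.Re (FS S x%:C%C).

(** Index n stands for the integer n + 1, so the generating function of the positive elements of S
    is x * s x, with [s] as below. *)
Definition indicator_succ n : R := (n.+1 \in S)%:R.

Local Notation s := (power_series indicator_succ).

Lemma CS_convolution n :
  CS R S n + \sum_(k < n) indicator_succ k * CS R S (n - k.+1) = 1.
Proof.
rewrite {1}CS_rec big_mkcond big_add1 /= big_mkord.
set u := \sum_(i < n) _; set v := \sum_(k < n) _.
suff -> : u = v by rewrite subrK.
apply: eq_bigr => k _; rewrite /indicator_succ.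
by case: ifP; rewrite ?mul1r ?mul0r.
Qed.

(** Finite form of F(x) (1 + x s(x)) = 1 / (1 - x). From M to M + 1 the left side grows by x^M times
    the sum in [CS_convolution], that is by x^M; the new index k = M meets P 0 = 0. *)
Lemma CS_partial_sums x M :
  let P := series (fun n => CS R S n * x ^+ n) in
  P M + \sum_(k < M) (x * (indicator_succ k * x ^+ k)) * P (M - k.+1)%N =
  series (geometric 1 x) M.
Proof.
move=> P; have P0 : P 0%N = 0 by rewrite /P /series /= big_geq.
elim: M => [|M IHM]; first by rewrite P0 big_ord0 addr0 /series /= big_geq.
rewrite [in RHS]seriesSr -{}IHM /P seriesSr -/P big_ord_recr /= subnn.
rewrite P0 mulr0 addr0.
rewrite -!addrA; congr (_ + _); rewrite mul1r.
have -> : \sum_(k < M) x * (indicator_succ k * x ^+ k) * P (M.+1 - k.+1)%N =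
    \sum_(k < M) x * (indicator_succ k * x ^+ k) * P (M - k.+1)%N +
    x ^+ M * \sum_(k < M) indicator_succ k * CS R S (M - k.+1).
  rewrite mulr_sumr -big_split /=; apply: eq_bigr => k _.
  rewrite subSS -[(M - k)%N](@prednK (M - k)) ?subn_gt0//.
  rewrite -subnS /P seriesSr mulrDr; congr (_ + _).
  have -> : x ^+ M = x ^+ (M - k.+1) * (x * x ^+ k).
    by rewrite -exprS -exprD subnK.
  ring.
rewrite addrCA; congr (_ + _).
by rewrite [_ * x ^+ M]mulrC -mulrDr CS_convolution mulr1.
Qed.

(** The coefficients are real, so all partial sums have imaginary part 0, and convergence comes from
    analyticity on the disk. *)
Lemma FS_real x : 0 <= x < 1 ->
  FS S x%:C%C = (G x)%:C%C /\
  series (fun n => CS R S n * x ^+ n) @ \oo --> G x.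
Proof.
move=> /andP[x0 x1].
have xlt1 : `|x%:C%C : R[i]^o| < 1.
  by rewrite normc_def /= expr0n /= addr0 sqrtr_sqr ger0_norm// ltcR.
have [cvF _] := FS_analytic xlt1.
have serE n : series (FS_term S x%:C%C) n =
    (series (fun n => CS R S n * x ^+ n) n)%:C%C.
  rewrite /series /= rmorph_sum /=; apply: eq_bigr => k _.
  by rewrite /FS_term rmorphM rmorphXn.
have [cvRe cvIm] := cvg_Re_Im cvF.
split; last first.
  by apply: cvg_trans cvRe; apply: near_eq_cvg; near=> n; rewrite serE.
have Im0 : complex.Im (FS S x%:C%C) = 0.
  have imE : (fun n => complex.Im (series (FS_term S x%:C%C) n)) = cst (0 : R).
    by apply/funext => n; rewrite serE.
  move: cvIm; rewrite imE => cvIm.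
  by rewrite -[LHS](cvg_lim (@Rhausdorff R) cvIm) lim_cst.
by rewrite /G; case: (FS S x%:C%C) Im0 => a b /= ->.
Unshelve. all: by end_near. Qed.

Lemma indicator_succ_bounded n : `|indicator_succ n| <= 1.
Proof.
by rewrite /indicator_succ; case: (_ \in _); rewrite ?normr1 ?normr0.
Qed.

Lemma is_cvg_indicator_series x : 0 <= x < 1 ->
  cvgn (series (fun n => indicator_succ n * x ^+ n)).
Proof. exact: is_cvg_bounded_power_series indicator_succ_bounded. Qed.

Lemma indicator_series_bounds x : 0 <= x < 1 -> 0 <= s x <= (1 - x)^-1.
Proof.
move=> x01; have /andP[x0 x1] := x01; have cv := is_cvg_indicator_series x01.
apply/andP; split.
  apply: limr_ge => //; near=> n; rewrite /series /= sumr_ge0// => k _.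
  by rewrite mulr_ge0 ?exprn_ge0// /indicator_succ.
have cvg : series (geometric 1 x) @ \oo --> 1 * (1 - x)^-1.
  by apply: cvg_geometric_series; rewrite ger0_norm.
rewrite -[leRHS]mul1r -(cvg_lim (@Rhausdorff R) cvg).
apply: lim_series_le => // [|n]; first by apply/cvg_ex; eexists; exact: cvg.
rewrite /= ler_wpM2r ?exprn_ge0//.
by apply: le_trans (ler_norm _) _; exact: indicator_succ_bounded.
Unshelve. all: by end_near. Qed.

Lemma FS_mul x : 0 <= x < 1 -> G x * (1 + x * s x) = (1 - x)^-1.
Proof.
move=> x01; have /andP[x0 x1] := x01; have [_ cvP] := FS_real x01.
have cvs := is_cvg_indicator_series x01.
pose a n := x * (indicator_succ n * x ^+ n).
have aE : a = x *: (fun n => indicator_succ n * x ^+ n) by [].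
have cva : cvgn (series a) by rewrite aE; exact: is_cvg_seriesZ.
have lima : limn (series a) = x * s x by rewrite aE lim_seriesZ.
have a0 n : 0 <= a n by rewrite !mulr_ge0 ?exprn_ge0// /indicator_succ.
have cvS : series (geometric 1 x) @ \oo --> G x + limn (series a) * G x.
  rewrite -(funext (CS_partial_sums x)).
  by apply: cvgD => //; exact: (cvg_convolution a0 cva cvP).
have cvg : series (geometric 1 x) @ \oo --> 1 * (1 - x)^-1.
  by apply: cvg_geometric_series; rewrite ger0_norm.
rewrite -[RHS]mul1r -(cvg_lim (@Rhausdorff R) cvg).
rewrite (cvg_lim (@Rhausdorff R) cvS) lima.
ring.
Qed.

Lemma FS_inv x : 0 <= x < 1 -> (G x)^-1 = (1 - x) * (1 + x * s x).
Proof.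
move=> x01; have /andP[x0 x1] := x01; have := FS_mul x01.
have h0 : 1 - x != 0 by rewrite subr_eq0 gt_eqF.
move=> h; have G0 : G x != 0.
  by apply/eqP => G0; move/eqP: h; rewrite G0 mul0r eq_sym invr_eq0 (negbTE h0).
by apply: (mulfI G0); rewrite mulfV// mulrCA h mulfV.
Qed.

(** Since (1 - x) s(x) <= 1, the inverse is at most (1 - x) + x. *)
Lemma FS_inv_bounds x : 0 <= x < 1 -> 0 < (G x)^-1 <= 1.
Proof.
move=> x01; have /andP[x0 x1] := x01; rewrite FS_inv//.
have /andP[s0 s1] := indicator_series_bounds x01.
have x1' : 0 < 1 - x by rewrite subr_gt0.
have xs : 0 <= x * s x by rewrite mulr_ge0.
apply/andP; split; first by rewrite mulr_gt0// ltr_pwDl.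
have h : (1 - x) * s x <= 1 by rewrite -ler_pdivlMl// mulr1.
have : x * ((1 - x) * s x) <= x * 1 by rewrite ler_wpM2l.
by rewrite mulr1 mulrDr mulr1 mulrCA; lra.
Qed.

Lemma FS_ge1 x : 0 <= x < 1 -> 1 <= G x.
Proof.
by move=> /FS_inv_bounds /andP[G0 G1]; rewrite -invf_le1// -invr_gt0.
Qed.

Lemma near_left1 : \forall x \near (1 : R)^'-, 0 < x < 1.
Proof.
near=> x; apply/andP; split; near: x; last exact: nbhs_left_lt.
by apply: nbhs_left_gt; exact: ltr01.
Unshelve. all: by end_near. Qed.

(** Stating the limit for 1 / G treats infinite L (A = 0) and finite L (A = 1 / L) alike. As 0 <= A
    <= 1, the indicator minus A is bounded by 1, and the Tauberian theorem shows that its means tend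
    to 0. *)
Lemma density_of_FS_inv A : (G x)^-1 @[x --> (1 : R)^'-] --> A ->
  has_density S A.
Proof.
move=> GA.
have A0 : 0 <= A.
  apply: (cvgr_to_ge GA); near=> x.
  have /andP[x0 x1] : 0 < x < 1 by near: x; exact: near_left1.
  have /FS_inv_bounds/andP[/ltW] : 0 <= x < 1 by rewrite (ltW x0).
  by [].
have A1 : A <= 1.
  apply: (cvgr_to_le GA); near=> x.
  have /andP[x0 x1] : 0 < x < 1 by near: x; exact: near_left1.
  have /FS_inv_bounds/andP[] : 0 <= x < 1 by rewrite (ltW x0).
  by [].
pose b n := indicator_succ n - A.
have b1 n : `|b n| <= 1.
  by rewrite /b /indicator_succ; case: (_ \in _); rewrite ler_norml /=; lra.
have id1 : x @[x --> (1 : R)^'-] --> (1 : R) by exact: cvg_at_left_filter.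
have b0 : (1 - x) * power_series b x @[x --> (1 : R)^'-] --> (0 : R).
  (* By [FS_inv] the quotient is (1 - x) s(x), and A is 1 - x times the sum of the series with
     constant coefficient A. *)
  have : ((G x)^-1 - (1 - x)) / x - A @[x --> (1 : R)^'-] --> (0 : R).
    have cvN : (G x)^-1 - (1 - x) @[x --> (1 : R)^'-] --> A - (1 - 1).
      by apply: cvgB => //; apply: cvgB => //; exact: cvg_cst.
    have cvV : x^-1 @[x --> (1 : R)^'-] --> (1^-1 : R).
      by apply: cvgV => //; exact: oner_neq0.
    have := cvgB (cvgM cvN cvV) (cvg_cst A).
    by rewrite subrr subr0 invr1 mulr1 subrr; apply.
  apply: cvg_trans; apply: near_eq_cvg; near=> x.
  have /andP[x0 x1] : 0 < x < 1 by near: x; exact: near_left1.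
  have x01 : 0 <= x < 1 by rewrite (ltW x0).
  have geo : series (geometric A x) @ \oo --> A * (1 - x)^-1.
    by apply: cvg_geometric_series; rewrite ger0_norm// ltW.
  have -> : power_series b x = s x - A * (1 - x)^-1.
    have -> : power_series b x = limn (series
        ((fun n => indicator_succ n * x ^+ n) - geometric A x)).
      rewrite /power_series; congr (limn (series _)); apply/funext => n.
      by rewrite /b mulrBl.
    rewrite lim_seriesB; first by rewrite (cvg_lim (@Rhausdorff R) geo).
      exact: is_cvg_indicator_series.
    by apply/cvg_ex; eexists; exact: geo.
  rewrite FS_inv//; field.
  by rewrite subr_eq0 !gt_eqF.
have cvA : (\sum_(n < N) b n) / N%:R + A @[N --> \oo] --> A.
  by have := cvgD (tauberian_bounded b1 b0) (cvg_cst A); rewrite add0r; apply.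
rewrite /has_density; apply: cvg_trans cvA; apply: near_eq_cvg; near=> N.
have N0 : (0 < N)%N by near: N; exact: nbhs_infty_gt.
have NR : N%:R != 0 :> R by rewrite pnatr_eq0 -lt0n.
have -> : (count (fun n => n \in S) (iota 1 N))%:R =
    \sum_(n < N) indicator_succ n :> R.
  rewrite -sum1_count natr_sum big_mkcond /=.
  have -> : iota 1 N = index_iota 1 N.+1 by rewrite /index_iota subn1.
  rewrite big_add1 /= big_mkord.
  by apply: eq_bigr => n _; rewrite /indicator_succ; case: ifP.
rewrite /= sumrB sumr_const card_ord mulrBl -[A *+ N]mulr_natr mulfK//.
by rewrite subrK.
Unshelve. all: by end_near. Qed.

End density.

Unset Implicit Arguments.

(** An infinite [L] is expressed through the modulus and does not see a sign, so the impossibility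
    of L < 1 has two parts: one for finite limits, one for divergence to -oo. *)
Theorem theorem2 (R : realType) (S : set nat) (S_pos : ~ S 0%N)
  (FS_analytic : FS_analytic_on_disk R S)
  (FS_neq0 : forall q : R[i]^o, `|q| < 1 -> FS S q <> 0)
  (L : option R[i]) (FS_lim : radial_limit (@FS R S) L) :
  [/\ L = None -> has_density S (0 : R),
      forall l : R, L = Some l%:C%C -> 1 <= l -> has_density S (1 / l),
      forall z : R[i], L = Some z -> exists l : R, z = l%:C%C /\ ~ l < 1
    & ~ (complex.Re (FS S x%:C%C) @[x --> (1 : R)^'-] --> -oo)].
Proof.
have FSge1 : \forall x \near (1 : R)^'-,
    FS S x%:C%C = (complex.Re (FS S x%:C%C))%:C%C /\
    1 <= complex.Re (FS S x%:C%C).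
  near=> x; have /andP[x0 x1] : 0 < x < 1 by near: x; exact: near_left1.
  have x01 : 0 <= x < 1 by rewrite (ltW x0).
  by split; [have [] := FS_real FS_analytic x01 | exact: FS_ge1].
split.
- move=> L0; subst L; apply: density_of_FS_inv => //.
  (* Near 1 the values are real and at least 1, so their modulus is their real part, and its inverse
     tends to 0. *)
  apply/gtr0_cvgV0.
    by near=> x; have [//|_] := near FSge1 x; exact: lt_le_trans.
  apply: cvg_trans FS_lim; apply: near_eq_cvg; near=> x.
  have [-> h] : FS S x%:C%C = (complex.Re (FS S x%:C%C))%:C%C /\
    1 <= complex.Re (FS S x%:C%C) by near: x.
  by rewrite /= expr0n /= addr0 sqrtr_sqr ger0_norm// (le_trans _ h).
- move=> l Ll l1; subst L; apply: density_of_FS_inv => //.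
  rewrite div1r; apply: cvgV; first by rewrite gt_eqF// (lt_le_trans _ l1).
  by have [] := cvg_Re_Im FS_lim.
- move=> z Lz; subst L; have [cvRe cvIm] := cvg_Re_Im FS_lim.
  exists (complex.Re z); split; last first.
    apply/negP; rewrite -leNgt; apply: (cvgr_to_ge cvRe).
    by near=> x; have [] := near FSge1 x.
  suff : complex.Im z = 0 by case: z {cvRe cvIm FS_lim} => a b /= ->.
  apply: (@cvg_unique _ (@Rhausdorff R) _ _ _ _ cvIm).
  apply: (@cvg_trans _ (cst 0 @ (1 : R)^'-)); last exact: cvg_cst.
  apply: near_eq_cvg; near=> x.
  by have [//|-> _] := near FSge1 x.
(* Near 1 the real part would be both at most 0 and at least 1. *)
- move=> /cvgrNyPle/(_ 0) FSle0.
  have : \forall x \near (1 : R)^'-, False.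
    near=> x; have [//|_ h] := near FSge1 x.
    have h0 : complex.Re (FS S x%:C%C) <= 0 by near: x.
    by have := le_trans h h0; rewrite ler10.
  by move/filter_ex => [].
Unshelve. all: by end_near. Qed.
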